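(* Let $G$ be a connected locally finite graph such that $|G|$ contains a Hamiltonian circle. Then $G$ has a non-elusive $\mathbb{Z}_4$-flow.
   Context: For a locally finite connected graph $G$, $|G|$ denotes the Freudenthal compactification of $G$ viewed as a $1$-dimensional CW complex (i.e. $G$ together with its ends). A circle in $|G|$ is a homeomorphic image of $S^1$ in $|G|$; a Hamiltonian circle is a circle in $|G|$ containing every vertex of $G$. A directed edge of $G=(V,E)$ is a triple $(e,x,y)$ with $e=xy\in E$. A cut is the set $E(X,Y)$ of all edges between $X$ and $Y=V\setminus X$ for some $X\subseteq V$. A non-elusive $\mathbb{Z}_4$-flow of $G$ is a map $f$ from the set of directed edges to $\mathbb{Z}_4\setminus\{0\}$ with $f(e,x,y)=-f(e,y,x)$ for every non-loop edge $e=xy$, such that for every finite cut $E(X,Y)$ the sum of $f(e,x,y)$ over all directed edges with $x\in X$, $y\in Y$ is $0$. *)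

(* Defs.v *)
From HB Require Import structures.
From mathcomp Require Import all_boot all_order all_algebra.
From mathcomp Require Import all_classical all_reals all_analysis.

Set Implicit Arguments.
Unset Strict Implicit.
Unset Printing Implicit Defensive.

Import Order.TTheory GRing.Theory Num.Theory.
Import numFieldNormedType.Exports.

Local Open Scope classical_set_scope.
Local Open Scope ring_scope.

(* Undirected multigraphs, possibly infinite, with loops and parallel edges
   allowed.  The order of the two endpoints [esrc e], [etgt e] is an arbitrary
   choice, used only to parametrise the edge [e] by the unit interval. *)
Record multigraph := Multigraph {
  vertex : choiceType;
  edge : choiceType;
  esrc : edge -> vertex;
  etgt : edge -> vertex }.

Definition joins (G : multigraph) (e : edge G) (x y : vertex G) : bool :=
  ((esrc e, etgt e) == (x, y)) || ((esrc e, etgt e) == (y, x)).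

Definition locally_finite (G : multigraph) : Prop :=
  forall x : vertex G, finite_set [set e : edge G | exists y, joins e x y].

Definition adjacent (G : multigraph) : rel (vertex G) :=
  fun x y => `[< exists e, joins e x y >].

Definition graph_connected (G : multigraph) : Prop :=
  forall x y : vertex G, exists2 p : seq (vertex G),
    path (@adjacent G) x p & last x p = y.

(* The triples (e, x, y) with e = xy; a loop at x gives only (e, x, x). *)
Definition directed_edge (G : multigraph) : Type :=
  {d : edge G * vertex G * vertex G | joins d.1.1 d.1.2 d.2}.

Definition dedge (G : multigraph) (e : edge G) (x y : vertex G)
    (h : joins e x y) : directed_edge G :=
  exist (fun d : edge G * vertex G * vertex G => is_true (joins d.1.1 d.1.2 d.2))
    (e, x, y) h.

Definition dsrc (G : multigraph) (d : directed_edge G) : vertex G := (val d).1.2.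
Definition dtgt (G : multigraph) (d : directed_edge G) : vertex G := (val d).2.

Definition cut (G : multigraph) (X : set (vertex G)) : set (edge G) :=
  [set e | exists x y, [/\ joins e x y, X x & ~ X y]].

(* When [cut X] is finite, so is the index set of the sum: each edge of the cut
   contributes exactly one directed edge leaving [X]. *)
Definition non_elusive_flow (G : multigraph) (A : zmodType)
    (f : directed_edge G -> A) : Prop :=
  [/\ forall d, f d != 0,
      forall (e : edge G) (x y : vertex G) (exy : joins e x y)
             (eyx : joins e y x), x != y -> f (dedge exy) = - f (dedge eyx)
    & forall X : set (vertex G), finite_set (cut X) ->
        \sum_(d \in [set d : directed_edge G | X (dsrc d) /\ ~ X (dtgt d)]) f d
        = 0].

(* The points of G as a 1-dimensional CW complex: its vertices (0-cells) and,
   for each edge, an open unit interval (1-cell). *)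
Inductive realization (R : realType) (G : multigraph) : Type :=
| CWVertex of vertex G
| CWInner of edge G & {t : R | 0 < t < 1}.
Arguments CWVertex R {G}.

(* Characteristic map of the 1-cell [e]; only its values on [0, 1] matter. *)
Definition cell_map (R : realType) (G : multigraph) (e : edge G) (t : R) :
    realization R G :=
  match insub t : option {t : R | 0 < t < 1} with
  | Some s => CWInner e s
  | None => CWVertex R (if t <= 0 then esrc e else etgt e)
  end.

Section RealizationTopology.
Variables (R : realType) (G : multigraph).

HB.instance Definition _ := gen_eqMixin (realization R G).
HB.instance Definition _ := gen_choiceMixin (realization R G).

(* Weak (CW) topology: the 0-skeleton being discrete, openness is tested on the
   closed 1-cells only. *)
Definition realization_open (U : set (realization R G)) : Prop :=
  forall e : edge G,
    open (@cell_map R G e @^-1` U : set (subspace `[0 : R, 1])).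

Lemma realization_openT : realization_open setT.
Proof. by move=> e; rewrite preimage_setT; exact: openT. Qed.

Lemma realization_openI : setI_closed realization_open.
Proof. by move=> U W oU oW e; rewrite preimage_setI; exact: openI. Qed.

Lemma realization_open_bigU (I : Type) (F : I -> set (realization R G)) :
  (forall i, realization_open (F i)) -> realization_open (\bigcup_i F i).
Proof.
by move=> oF e; rewrite preimage_bigcup; apply: bigcup_open => i _; exact: oF.
Qed.

HB.instance Definition _ := isOpenTopological.Build (realization R G)
  realization_openT realization_openI realization_open_bigU.

End RealizationTopology.

(* A topological end of [X] picks, compatibly, a connected component of the
   complement of each compact set. *)
Record space_end (X : topologicalType) := SpaceEnd {
  end_comp : forall K : set X, compact K -> set X;
  end_compP : forall (K : set X) (cK : compact K), exists2 x : X,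
    (~` K) x & end_comp cK = connected_component (~` K) x;
  end_comp_sub : forall (K L : set X) (cK : compact K) (cL : compact L),
    K `<=` L -> end_comp cL `<=` end_comp cK }.
Arguments end_comp_sub {X} w {K L} cK cL _ : rename.

Inductive freudenthal (X : topologicalType) : Type :=
| FPoint of X
| FEnd of space_end X.
Arguments FPoint {X}.
Arguments FEnd {X}.

Section FreudenthalTopology.
Variable X : topologicalType.

HB.instance Definition _ := gen_eqMixin (freudenthal X).
HB.instance Definition _ := gen_choiceMixin (freudenthal X).

(* The basic neighbourhood of an end w given by a compact set K: the component
   C of X \ K chosen by w, with all the ends that also choose C. *)
Definition end_nbhs (w : space_end X) (K : set X) (cK : compact K) :
    set (freudenthal X) :=
  [set p | match p with
           | FPoint x => end_comp w cK x
           | FEnd w' => end_comp w' cK = end_comp w cK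
           end].

Definition freudenthal_open (U : set (freudenthal X)) : Prop :=
  open (FPoint @^-1` U) /\
  forall w, U (FEnd w) -> exists (K : set X) (cK : compact K),
    end_nbhs w cK `<=` U.

Lemma freudenthal_openT : freudenthal_open setT.
Proof.
split=> [|w _]; first by rewrite preimage_setT; exact: openT.
by exists set0, compact0.
Qed.

Lemma end_comp_eq_sub (w w' : space_end X) (K L : set X) (cK : compact K)
  (cL : compact L) : K `<=` L -> end_comp w' cL = end_comp w cL ->
  end_comp w' cK = end_comp w cK.
Proof.
move=> KL ww'.
have [z Lz wL] := end_compP w cL.
have wLz : end_comp w cL z.
  by rewrite wL; exact: connected_component_refl.
have zw : end_comp w cK z by exact: (end_comp_sub w cK cL KL z wLz).
have zw' : end_comp w' cK z by apply: (end_comp_sub w' cK cL KL); rewrite ww'.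
have [x _ xE] := end_compP w cK; have [x' _ xE'] := end_compP w' cK.
move: zw zw'; rewrite xE xE' => /same_connected_component -> .
by move=> /same_connected_component ->.
Qed.

Lemma freudenthal_openI : setI_closed freudenthal_open.
Proof.
move=> U W [oU eU] [oW eW]; split; first by rewrite preimage_setI; exact: openI.
move=> w [/eU [K [cK KU]] /eW [L [cL LW]]].
have [KKL LKL] : K `<=` K `|` L /\ L `<=` K `|` L.
  by split; [exact: subsetUl | exact: subsetUr].
exists (K `|` L), (compactU cK cL) => p wp.
split; [apply: KU | apply: LW]; case: p wp => [x|w'] /=.
- exact: (end_comp_sub w cK (compactU cK cL) KKL).
- exact: (end_comp_eq_sub cK KKL).
- exact: (end_comp_sub w cL (compactU cK cL) LKL).
- exact: (end_comp_eq_sub cL LKL).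
Qed.

Lemma freudenthal_open_bigU (I : Type) (F : I -> set (freudenthal X)) :
  (forall i, freudenthal_open (F i)) -> freudenthal_open (\bigcup_i F i).
Proof.
move=> oF; split.
  by rewrite preimage_bigcup; apply: bigcup_open => i _; case: (oF i).
move=> w [i _ /(proj2 (oF i)) [K [cK KF]]].
by exists K, cK => p /KF Fp; exists i.
Qed.

HB.instance Definition _ := isOpenTopological.Build (freudenthal X)
  freudenthal_openT freudenthal_openI freudenthal_open_bigU.

End FreudenthalTopology.

Definition unit_circle (R : realType) : set (R * R) :=
  [set z | z.1 ^+ 2 + z.2 ^+ 2 = 1].

Definition homeomorphic_sets (S T : topologicalType) (A : set S) (B : set T) :
    Prop :=
  exists (h : S -> T) (g : T -> S),
    [/\ h @` A = B, {within A, continuous h}, {within B, continuous g}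
      & forall z, A z -> g (h z) = z].

Definition is_circle (R : realType) (T : topologicalType) (C : set T) : Prop :=
  homeomorphic_sets (@unit_circle R) C.

Definition hamiltonian_circle (R : realType) (G : multigraph)
    (C : set (freudenthal (realization R G))) : Prop :=
  is_circle R C /\ forall v : vertex G, C (FPoint (CWVertex R v)).

(* Main.v *)
From HB Require Import structures.
Require Import Defs.
From mathcomp Require Import all_boot all_order all_algebra.
From mathcomp Require Import finmap.
From mathcomp Require Import all_classical all_reals all_analysis.
From mathcomp Require Import ring lra zify.

(** Why the theorem holds.  Let [D] be the set of edges whose midpoint lies on
    the Hamiltonian circle.

    Topology: every finite cut meets [D] in an even number of edges, and a
    nonempty finite cut meets [D] in at least one
    ([hamiltonian_circle_transversal]).  Deleting the midpoints of the edges of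
    a finite cut [cut X] splits |G| into two disjoint open sets, the side of [X]
    and the side of its complement; an end lies on the side that contains its
    component of the complement of these finitely many points
    ([side_ends_cover]).  The circle minus a vertex is a line
    ([punctured_circle_line]) running injectively through |G|.  Inside an edge
    it is strictly monotone, so it changes sides at each midpoint it meets
    ([passes_midpoint]); both of its ends tend to the deleted vertex, hence to
    the same side, so the number of changes is even ([sign_changes_parity]).
    With no change at all the line stays on one side, and as it carries all
    vertices the cut is empty.

    Algebra: such a [D] yields a nowhere-zero flow in Z/4
    ([Z4_flow_of_even_transversal]), as a spanning connected Eulerian subgraph
    does in a finite graph.  One finds a set of edges [Z] that contains all
    edges outside [D] and meets every finite cut evenly, then an orientation of
    [Z] that is balanced modulo 4 across every finite cut, and takes the
    values +-1 along that orientation on [Z], plus 2 on [D].  The result is odd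
    on [Z] and equal to 2 on the rest of [D].

    Both [Z] and its orientation solve systems of linear equations over F_2, one
    equation for each finite cut, in infinitely many unknowns.  Each equation
    has finite support, so the only obstruction is a combination of the
    equations with zero left-hand side and nonzero right-hand side
    ([parity_solution]): the functional to be represented extends from the span
    of the left-hand sides to the whole space ([linear_relation_extends]).  For
    [Z] there is no obstruction because a finite cut that avoids [D] is empty;
    for the orientation there is none because a cut that avoids [Z] imposes no
    condition. *)

Set Implicit Arguments.
Unset Strict Implicit.
Unset Printing Implicit Defensive.

Import Order.TTheory GRing.Theory Num.Theory.
Import numFieldNormedType.Exports.
(* From here on, [cut] is a cut of a graph, not of the real line. *)
Import Defs.

Local Open Scope classical_set_scope.
Local Open Scope ring_scope.

(** * Extending linear functionals *)

(** The graph of a linear functional defined on some subspace of [V]. *)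
Definition linear_relation (K : fieldType) (V : lmodType K)
    (Q : set (V * K^o)%type) : Prop :=
  [/\ Q (0, 0), forall a x y, Q x -> Q y -> Q (a *: x + y)
    & forall b, Q (0, b) -> b = 0].

(** Extension of a partial linear functional to the whole space, by Zorn: a
    maximal functional graph containing [Q] is total, since a vector without an
    image could be sent to 0. *)
Lemma linear_relation_extends (K : fieldType) (V : lmodType K)
    (Q : set (V * K^o)%type) : linear_relation Q ->
  exists phi : {scalar V}, forall v b, Q (v, b) -> phi v = b.
Proof.
move=> lQ; pose P A := linear_relation (Q `|` A).
(* Maximality is taken among the sets [A] added to [Q], so that [Q] itself
   bounds the empty chain. *)
have [A [[QA0 QAl QAf] Amax]] : exists A, P A /\ forall B, A `<` B -> ~ P B.
  apply: Zorn_bigcup => F FP Ftot.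
  have [->|/set0P[A0 FA0]] := eqVneq F set0.
    by rewrite /P bigcup_set0 setU0.
  have inF A x : F A -> (Q `|` A) x -> (Q `|` \bigcup_(X in F) X) x.
    by move=> FA [Qx|Ax]; [left|right; exists A].
  have outF x : (Q `|` \bigcup_(X in F) X) x -> exists2 A, F A & (Q `|` A) x.
    by case=> [Qx|[A FA Ax]]; [exists A0 => //; left|exists A => //; right].
  split.
  - by left; case: lQ.
  - move=> a x y /outF[A FA Ax] /outF[B FB By].
    have [AB|BA] := Ftot A B FA FB.
      have [_ + _] := FP _ FB; move=> /(_ a x y) Bl; apply: (inF B) => //.
      by apply: Bl => //; case: Ax => [?|/AB ?]; [left|right].
    have [_ + _] := FP _ FA; move=> /(_ a x y) Al; apply: (inF A) => //.
    by apply: Al => //; case: By => [?|/BA ?]; [left|right].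
  - by move=> b /outF[A FA]; have [_ _] := FP _ FA; apply.
have total v : exists b, (Q `|` A) (v, b).
  apply: contrapT => /forallNP vN.
  pose B := [set x | exists a y, (Q `|` A) y /\ x = y + a *: (v, 0 : K^o)].
  have subB : Q `|` A `<=` B by move=> x Ax; exists 0, x; rewrite scale0r addr0.
  have QB : Q `|` B = B by apply/setUidPr => x Qx; apply: subB; left.
  apply: (Amax B); last first.
    rewrite /P QB; split; first exact: subB.
    - move=> a _ _ [a1 [x [Ax ->]]] [a2 [y [Ay ->]]].
      exists (a * a1 + a2), (a *: x + y); split; first exact: QAl.
      by rewrite scalerDr scalerDl scalerA addrACA.
    - move=> b [a [[w c]]] [Aw [/= w0 ->]]; rewrite scaler0 addr0.
      have [a0|a0] := eqVneq a 0.
        by apply: QAf; rewrite w0 a0 scale0r addr0.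
      exfalso; apply: (vN (- a^-1 * c)).
      have := QAl (- a^-1) _ _ Aw QA0; rewrite addr0.
      suff -> : - a^-1 *: (w, c) = (v, - a^-1 * c) by [].
      congr pair; have -> : w = - (a *: v) by apply/eqP; rewrite -addr_eq0 -w0.
      by rewrite scalerN scaleNr opprK scalerA mulVf// scale1r.
  split=> [|/(_ (v, 0)) BA]; first by move=> x Ax; apply: subB; right.
  apply: (vN 0); right; apply: BA; exists 1, (0, 0); split=> //.
  by rewrite scale1r add0r.
pose phi v := projT1 (cid (total v)).
have phiP v : (Q `|` A) (v, phi v) by rewrite /phi; case: cid.
have phiE v b : (Q `|` A) (v, b) -> phi v = b.
  move=> Avb; apply/eqP; rewrite -subr_eq0; apply/eqP/QAf.
  have := QAl (-1) _ _ Avb (phiP v); rewrite scaleN1r.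
  by congr ((Q `|` A) (_, _)) => /=; rewrite addrC ?subrr.
have phi_lin : scalar phi.
  by move=> a u v; apply: phiE; exact: (QAl a _ _ (phiP u) (phiP v)).
pose phiL := GRing.isLinear.Build K V K *%R phi phi_lin.
pose phiS : {scalar V} := HB.pack phi phiL.
exists phiS => v b Qvb /=.
by apply: phiE; left.
Qed.

(** Only vectors of finite support are evaluated, so the values of an extension
    on the unit vectors determine it there. *)
Lemma finite_relation_dual (K : fieldType) (E : choiceType)
    (Q : set ((E -> K^o) * K^o)%type) : linear_relation Q ->
  exists h : E -> K, forall c b (A : set E), Q (c, b) -> finite_set A ->
    (forall e, ~ A e -> c e = 0) -> \sum_(e \in A) c e * h e = b.
Proof.
move=> /linear_relation_extends[phi phiQ].
pose delta e : E -> K^o := fun e' => (e' == e)%:R.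
exists (fun e => phi (delta e)) => c b A Qcb finA cA.
rewrite -(phiQ _ _ Qcb) fsbig_finite//=.
have {2}-> : c = \sum_(e <- fset_set A) c e *: delta e.
  apply/funext => e; rewrite fct_sumE.
  have [Ae|Ae] := pselect (A e); last first.
    rewrite cA// big_seq big1// => e'; rewrite in_fset_set// inE => Ae'.
    rewrite fctE /delta/=; case: eqP => [ee'|_]; last by rewrite scaler0.
    by rewrite ee' in Ae.
  rewrite (bigD1_seq e)/= ?fset_uniq ?in_fset_set ?inE//.
  rewrite big1 ?addr0; first by rewrite fctE /delta eqxx; exact/esym/mulr1.
  by move=> e' ee'; rewrite fctE /delta eq_sym (negbTE ee') scaler0.
rewrite linear_sum/=; apply: eq_bigr => e _; rewrite linearZ/=; congr (_ * _).
Qed.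

(** * Coboundaries and fluxes across finite cuts *)

Lemma intrF2_eq0 (m : int) : (m%:~R == 0 :> 'F_2) = (2 %| m)%Z.
Proof.
have natF2 n : (n%:R == 0 :> 'F_2) = (2 %| n)%N.
  by rewrite -(dvdn_pcharf (pchar_Fp (isT : prime 2))).
by case: m => n; rewrite ?NegzE ?mulrNz ?oppr_eq0 -?pmulrn natF2.
Qed.

Lemma F2_cases (a : 'F_2) : a = 0 \/ a = 1.
Proof. by case: a => [[|[|//]] a2]; [left|right]; apply/val_inj. Qed.

Section Coboundary.
Variable G : multigraph.
Implicit Types (X Y : set (vertex G)) (e : edge G) (k : edge G -> int).

(** The sign with which the edge, directed from [esrc e] to [etgt e], leaves
    [X]. *)
Definition coboundary X e : int := (esrc e \in X)%:Z - (etgt e \in X)%:Z.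

(** The net amount leaving [X] when [k e] is carried from [esrc e] to
    [etgt e]. *)
Definition flux k X : int := \sum_(e \in cut X) coboundary X e * k e.

Lemma cutE X e : cut X e <-> (esrc e \in X) != (etgt e \in X).
Proof.
split=> [[x [y [exy Xx Xy]]]|].
  by case/orP: exy => /eqP[-> ->]; rewrite (mem_set Xx) (memNset Xy).
case: (boolP (esrc e \in X)) => sX; case: (boolP (etgt e \in X)) => // tX _.
  exists (esrc e), (etgt e); split; rewrite ?/joins ?eqxx//; first exact/set_mem.
  by move/mem_set; apply/negP.
exists (etgt e), (esrc e); split; rewrite ?/joins ?eqxx ?orbT//.
  exact/set_mem.
by move/mem_set; apply/negP.
Qed.

Lemma coboundaryNcut X e : ~ cut X e -> coboundary X e = 0.
Proof.
by rewrite cutE /coboundary => /negP; rewrite negbK => /eqP->; rewrite subrr.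
Qed.

Lemma coboundary_cut X e : cut X e -> coboundary X e = 1 \/ coboundary X e = -1.
Proof.
rewrite cutE /coboundary.
by case: (_ \in _); case: (_ \in _) => // _; [left|right].
Qed.

Lemma cut0 : cut (set0 : set (vertex G)) = set0.
Proof. by rewrite -subset0 => e [x [y []]]. Qed.

Lemma flux0 k : flux k set0 = 0.
Proof. by rewrite /flux cut0 fsbig_set0. Qed.

Definition symdiff X Y := (X `\` Y) `|` (Y `\` X).

Lemma in_symdiff X Y v : (v \in symdiff X Y) = (v \in X) (+) (v \in Y).
Proof.
by rewrite /symdiff in_setU !in_setD; case: (_ \in X); case: (_ \in Y).
Qed.

(** Coboundaries are additive modulo 2 for symmetric differences; the exact
    correction term is what controls halves of fluxes modulo 2. *)
Lemma coboundary_symdiff X Y e :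
  coboundary (symdiff X Y) e =
  coboundary X e + coboundary Y e - 2 * coboundary (X `&` Y) e.
Proof.
rewrite /coboundary !in_symdiff !in_setI.
by case: (_ e \in X); case: (_ e \in X); case: (_ e \in Y); case: (_ e \in Y).
Qed.

Lemma cut_symdiff X Y : cut (symdiff X Y) `<=` cut X `|` cut Y.
Proof.
move=> e /cutE; rewrite !in_symdiff /setU/= !cutE.
by case: (_ e \in X); case: (_ e \in X); case: (_ e \in Y); case: (_ e \in Y);
  move=> //= _; by [left|right].
Qed.

Lemma cut_setI X Y : cut (X `&` Y) `<=` cut X `|` cut Y.
Proof.
move=> e /cutE; rewrite !in_setI /setU/= !cutE.
by case: (_ e \in X); case: (_ e \in X); case: (_ e \in Y); case: (_ e \in Y);
  move=> //= _; by [left|right].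
Qed.

Lemma finite_cut_symdiff X Y :
  finite_set (cut X) -> finite_set (cut Y) -> finite_set (cut (symdiff X Y)).
Proof.
by move=> fX fY; apply: sub_finite_set (@cut_symdiff X Y) _; rewrite finite_setU.
Qed.

Lemma finite_cut_setI X Y :
  finite_set (cut X) -> finite_set (cut Y) -> finite_set (cut (X `&` Y)).
Proof.
by move=> fX fY; apply: sub_finite_set (@cut_setI X Y) _; rewrite finite_setU.
Qed.

Lemma flux_widen k X (A : set (edge G)) : cut X `<=` A ->
  flux k X = \sum_(e \in A) coboundary X e * k e.
Proof.
move=> XA; apply: fsbig_widen => // e [_ Xe] /=.
by rewrite coboundaryNcut// mul0r.
Qed.

Lemma flux_symdiff k X Y : finite_set (cut X) -> finite_set (cut Y) ->
  flux k (symdiff X Y) = flux k X + flux k Y - 2 * flux k (X `&` Y).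
Proof.
move=> fX fY; pose A := cut X `|` cut Y.
have fA : finite_set A by rewrite finite_setU.
rewrite (flux_widen k (@cut_symdiff X Y)) (flux_widen k (@cut_setI X Y)).
rewrite (flux_widen k (@subsetUl _ (cut X) (cut Y))).
rewrite (flux_widen k (@subsetUr _ (cut X) (cut Y))) -/A.
rewrite !fsbig_finite//= mulr_sumr -sumrN -!big_split/=.
by apply: eq_bigr => e _; rewrite coboundary_symdiff; ring.
Qed.

Lemma eq_flux k1 k2 X : (forall e, cut X e -> k1 e = k2 e) ->
  flux k1 X = flux k2 X.
Proof. by move=> kE; apply: eq_fsbigr => e /set_mem/kE ->. Qed.

Lemma fluxD k1 k2 X : finite_set (cut X) ->
  flux (fun e => k1 e + k2 e) X = flux k1 X + flux k2 X.
Proof.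
move=> fX; rewrite /flux !fsbig_finite//= -big_split/=.
by apply: eq_bigr => e _; rewrite mulrDr.
Qed.

Lemma fluxZ a k X : finite_set (cut X) ->
  flux (fun e => a * k e) X = a * flux k X.
Proof.
move=> fX; rewrite /flux !fsbig_finite//= mulr_sumr.
by apply: eq_bigr => e _; rewrite mulrCA.
Qed.

(** Solvability of the system of equations
    sum over e in [cut X] of [w e * h e] = [beta X] modulo 2, for all finite
    cuts, with unknown [h].  The left-hand sides and right-hand sides are
    additive for symmetric differences, and by the last hypothesis a vanishing
    left-hand side forces a vanishing right-hand side: the pairs of sides form a
    linear relation, and the unknowns are the values of an extension on the unit
    vectors. *)
Lemma parity_solution (w : edge G -> int) (beta : set (vertex G) -> int) :
    (2 %| beta set0)%Z ->
    (forall X Y, finite_set (cut X) -> finite_set (cut Y) ->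
       (2 %| beta (symdiff X Y) - (beta X + beta Y))%Z) ->
    (forall X, finite_set (cut X) -> (forall e, cut X e -> (2 %| w e)%Z) ->
       (2 %| beta X)%Z) ->
  exists h : edge G -> bool, forall X, finite_set (cut X) ->
    (2 %| flux (fun e => w e * (h e)%:Z) X - beta X)%Z.
Proof.
move=> beta0 betaD betaK.
pose row X : edge G -> ('F_2)^o := fun e => (coboundary X e * w e)%:~R.
pose Q : set ((edge G -> ('F_2)^o) * ('F_2)^o)%type :=
  [set p | exists2 X, finite_set (cut X) & p = (row X, (beta X)%:~R)].
have rowD X Y : row (symdiff X Y) = row X + row Y.
  apply/funext => e; rewrite !fctE /row -rmorphD/=.
  apply/eqP; rewrite -subr_eq0 -rmorphB/= intrF2_eq0 coboundary_symdiff.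
  apply/dvdzP; exists (- (coboundary (X `&` Y) e * w e)); ring.
have lQ : linear_relation Q.
  have Q0 : Q (0, 0).
    exists set0; first by rewrite cut0.
    congr pair; last by apply/esym/eqP; rewrite intrF2_eq0.
    by apply/funext => e; rewrite /row coboundaryNcut ?mul0r// cut0.
  split=> //.
  - move=> a x y Qx Qy; have [->|->] := F2_cases a.
      by rewrite scale0r add0r.
    rewrite scale1r; case: Qx => X fX ->; case: Qy => Y fY ->.
    exists (symdiff X Y); first exact: finite_cut_symdiff.
    rewrite rowD; congr pair => /=; apply/esym/eqP.
    by rewrite -rmorphD/= -subr_eq0 -rmorphB/= intrF2_eq0 betaD.
  - move=> _ [X fX [row0 ->]]; apply/eqP; rewrite intrF2_eq0.
    apply: betaK => // e Xe.
    have /esym/eqP := congr1 (fun f => f e) row0.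
    rewrite intrF2_eq0; have [->|->] := coboundary_cut Xe; first by rewrite mul1r.
    by rewrite mulN1r rpredN.
have [h hP] := finite_relation_dual lQ.
exists (fun e => h e != 0) => X fX.
have := hP (row X) _ (cut X) (ex_intro2 _ _ X fX erefl) fX.
rewrite -intrF2_eq0 rmorphB/= subr_eq0 => <-; last first.
  by move=> e Xe; rewrite /row coboundaryNcut// mul0r.
rewrite /flux !fsbig_finite//= rmorph_sum/=; apply/eqP/eq_bigr => e _.
rewrite /row mulrA rmorphM/=; congr (_ * _).
by have [->|->] := F2_cases (h e).
Qed.
End Coboundary.

(** * Flows from edge sets meeting all finite cuts evenly *)

Lemma directed_edge_bij (G : multigraph) (X : set (vertex G)) :
  set_bij [set d : directed_edge G | X (dsrc d) /\ ~ X (dtgt d)] (cut X)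
    (fun d => (val d).1.1).
Proof.
split.
- move=> [[[e x] y] exy]; rewrite /dsrc /dtgt /= => -[Xx Xy].
  by exists x, y.
- move=> [[[e x] y] exy] [[[e' x'] y'] exy'] /set_mem; rewrite /dsrc /dtgt /=.
  move=> [Xx Xy] /set_mem[/= Xx' Xy'] ee'; apply/val_inj; subst e'.
  move: exy exy' Xx Xy Xx' Xy'; rewrite /joins /=.
  by move=> /orP[]/eqP[<- <-] /orP[]/eqP[<- <-].
- move=> e [x [y [exy Xx Xy]]].
  by exists (dedge exy).
Qed.


(** The combinatorial half of the proof: [D] behaves like the edge set of a
    spanning connected Eulerian subgraph, and the flow is built from a set [z]
    containing the complement of [D] and from a reversal [h2] of some of its
    edges. *)
Theorem Z4_flow_of_even_transversal (G : multigraph) (D : set (edge G)) :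
    (forall X, finite_set (cut X) -> ~~ odd #|` fset_set (cut X `&` D)|%fset) ->
    (forall X, finite_set (cut X) -> cut X `&` D = set0 -> cut X = set0) ->
  exists f : directed_edge G -> 'Z_4, non_elusive_flow f.
Proof.
move=> Deven Dmeets.
pose oneD e : int := (e \in D)%:Z; pose oneC e : int := (e \notin D)%:Z.
have fluxD_even X : finite_set (cut X) -> (2 %| flux oneD X)%Z.
  move=> fX; rewrite -intrF2_eq0 /flux fsbig_finite//= rmorph_sum/=.
  have -> : \sum_(e <- fset_set (cut X)) (coboundary X e * oneD e)%:~R =
      (#|` fset_set (cut X `&` D)|%fset)%:R :> 'F_2.
    have fXD : finite_set (cut X `&` D) by apply: sub_finite_set fX => e [].
    rewrite -sum1_size natr_sum -(fsbig_finite _ _ fXD)/=.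
    rewrite fsbig_mkcondr fsbig_finite//= !big_seq.
    apply: eq_bigr => e; rewrite in_fset_set// inE => Xe.
    by rewrite /oneD; case: (e \in D) => /=;
       have [->|->] := coboundary_cut Xe; apply/val_inj.
  have := Deven X fX; rewrite -dvdn2 => e2.
  by have := intrF2_eq0 (#|` fset_set (cut X `&` D)|%fset); rewrite -pmulrn => ->.
(* Completes the complement of [D] by edges of [D] to a set [z] meeting every
   finite cut evenly. *)
have [h hP] : exists h : edge G -> bool, forall X, finite_set (cut X) ->
    (2 %| flux (fun e => oneD e * (h e)%:Z) X - flux oneC X)%Z.
  apply: parity_solution => [|X Y fX fY|X fX even].
  - by rewrite flux0.
  - by rewrite flux_symdiff//; lia.
  - suff XD : cut X `&` D = set0 by rewrite /flux Dmeets// fsbig_set0.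
    rewrite -subset0 => e [/even + De].
    by rewrite /oneD (mem_set De).
pose z e := (e \notin D) || h e.
have z_even X : finite_set (cut X) -> (2 %| flux (fun e => (z e)%:Z) X)%Z.
  move=> fX; have := hP X fX.
  have -> : flux (fun e => (z e)%:Z) X =
      flux oneC X + flux (fun e => oneD e * (h e)%:Z) X.
    rewrite -fluxD//; apply: eq_flux => e _; rewrite /z /oneC /oneD.
    by case: (e \in D); case: (h e).
  lia.
(* The flux of [z] across a finite cut is even; reversing an edge changes it by
   2 modulo 4, so the edges to reverse are prescribed by its half modulo 2. *)
have [h2 h2P] : exists h2 : edge G -> bool, forall X, finite_set (cut X) ->
    (2 %| flux (fun e => (z e)%:Z * (h2 e)%:Z) X -
           (flux (fun e => (z e)%:Z) X %/ 2)%Z)%Z.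
  apply: parity_solution => [|X Y fX fY|X fX even].
  - by rewrite flux0.
  (* Halves of fluxes are additive modulo 2 because the correction term is
     again the flux of [z] across a finite cut. *)
  - have := z_even _ (finite_cut_setI fX fY).
    have := z_even X fX; have := z_even Y fY.
    by rewrite flux_symdiff//; lia.
  - rewrite /flux fsbig1// => e Xe; have := even e Xe.
    by case: (z e) => //; rewrite mulr0.
pose k e : int := (z e)%:Z * (1 - 2 * (h2 e)%:Z) + 2 * oneD e.
have kflux X : finite_set (cut X) -> (4 %| flux k X)%Z.
  move=> fX; have := h2P X fX; have := z_even X fX; have := fluxD_even X fX.
  have -> : flux k X = flux (fun e => (z e)%:Z) X
      + ((-2) * flux (fun e => (z e)%:Z * (h2 e)%:Z) X + 2 * flux oneD X).
    rewrite -!fluxZ// -!fluxD//; apply: eq_flux => e _; rewrite /k; ring.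
  lia.
have k_neq0 e : (k e)%:~R != 0 :> 'Z_4.
  rewrite /k /z /oneD; case: (e \in D); case: (h e); case: (h2 e); by [].
pose f (d : directed_edge G) : 'Z_4 :=
  if dsrc d == esrc (val d).1.1 then (k (val d).1.1)%:~R
  else - (k (val d).1.1)%:~R.
exists f; split.
- by move=> d; rewrite /f; case: ifP => _; rewrite ?oppr_eq0 k_neq0.
- move=> e x y exy eyx xy; rewrite /f /dsrc /=.
  case/orP: (exy) => /eqP[-> _].
    by rewrite eqxx eq_sym (negbTE xy) opprK.
  by rewrite eqxx (negbTE xy).
move=> X fX.
have f_edge (d : directed_edge G) : X (dsrc d) -> ~ X (dtgt d) ->
    f d = (coboundary X (val d).1.1 * k (val d).1.1)%:~R.
  case: d => [[[e x] y] exy]; rewrite /f /dsrc /dtgt /= => Xx Xy.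
  rewrite /coboundary; move: exy; rewrite /joins => /orP[]/eqP[-> ->].
    by rewrite eqxx (mem_set Xx) (memNset Xy) mul1r.
  rewrite (mem_set Xx) (memNset Xy) ifF; first by rewrite mulN1r mulrNz.
  by apply/eqP => xy; rewrite xy in Xx.
transitivity (\sum_(e \in cut X) ((coboundary X e * k e)%:~R : 'Z_4)).
  rewrite (reindex_fsbig _ _ _ _ (directed_edge_bij X)).
  by apply: eq_fsbigr => d /set_mem[Xd Xd']; exact: f_edge.
rewrite fsbig_finite//= -rmorph_sum/=.
have /dvdzP[m] := kflux X fX; rewrite /flux fsbig_finite//= => ->.
by rewrite rmorphM/= (_ : 4%:~R = 0) ?mulr0//; apply/val_inj.
Qed.

(** * Counting the changes of side of a line *)

Lemma connected_sub_disjoint_open (T : topologicalType) (P N C : set T) :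
    open P -> open N -> P `&` N = set0 -> connected C -> C `<=` P `|` N ->
  C `<=` P \/ C `<=` N.
Proof.
move=> oP oN PN0 connC CPN; apply: connected_subset CPN connC.
have disj A B : open B -> A `&` B = set0 -> closure A `&` B = set0.
  move=> oB AB; rewrite -subset0 => x [clAx Bx].
  have [y ABy] := clAx B (open_nbhs_nbhs (conj oB Bx)).
  by rewrite AB in ABy.
by split; [exact: disj|rewrite setIC; apply: disj => //; rewrite setIC].
Qed.

Section SignChanges.
Variable R : realType.
Implicit Types (P N : set R) (s : R) (S : seq R).

Definition passes P N s := exists2 d : R, 0 < d &
  (forall t, s - d < t < s -> P t) /\ (forall t, s < t < s + d -> N t).

Lemma constant_side P N (a b : R) : open P -> open N -> P `&` N = set0 ->
    a <= b -> (forall t, a <= t <= b -> P t \/ N t) -> P a -> P b.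
Proof.
move=> oP oN PN0 ab abPN Pa.
have sub : `[a, b] `<=` P `|` N.
  by move=> t; rewrite /= in_itv; exact: abPN.
have aab : `[a, b]%classic a by rewrite /= in_itv /= lexx ab.
have bab : `[a, b]%classic b by rewrite /= in_itv /= lexx ab.
have [abP|abN] :=
  connected_sub_disjoint_open oP oN PN0 (@segment_connected _ a b) sub.
  exact: abP.
have : (P `&` N) a by split => //; exact: abN.
by rewrite PN0.
Qed.

(** The line is on side [P] before the first crossing, on side [N] between the
    first and the second, and so on: restart just after the first crossing with
    the two sides exchanged. *)
Lemma sign_changes_parity P N (S : seq R) (a b : R) :
    open P -> open N -> P `&` N = set0 ->
    path <%R a S -> last a S < b ->
    (forall t, a <= t <= b -> t \notin S -> P t \/ N t) ->
    (forall s, s \in S -> passes P N s \/ passes N P s) ->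
  P a -> if odd (size S) then N b else P b.
Proof.
elim: S P N a => [|s S IH] P N a oP oN PN0 /=.
  move=> _ ab abPN _.
  by apply: (constant_side oP oN PN0) (ltW ab) _ => t /abPN; apply.
move=> /andP[as_ sS] lastb abPN pass Pa.
have [n [sn nb S_ge_n]] :
    exists n, [/\ s < n, n <= b & forall t, t \in S -> n <= t].
  case: S sS lastb {IH abPN pass} => [|n S] /=; first by exists b.
  rewrite lt_path_sortedE => /andP[sn /andP[/allP nS _]] lastb.
  have S_ge_n t : t \in n :: S -> n <= t.
    by rewrite inE => /orP[/eqP->//|/nS/ltW].
  by exists n; split=> //; exact/(le_trans (S_ge_n _ (mem_last n S)))/ltW.
have left_of t : a <= t < s -> P t.
  move=> /andP[at_ ts]; apply: (constant_side oP oN PN0 at_) => // u /andP[au ut].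
  have us : u < s by exact: le_lt_trans ts.
  apply: abPN; first by rewrite au (le_trans (ltW us))// (le_trans (ltW sn)).
  rewrite inE negb_or (lt_eqF us)/=; apply/negP => /S_ge_n nu.
  by have := lt_trans us (lt_le_trans sn nu); rewrite ltxx.
have [d d0 right_of] : exists2 d : R, 0 < d & forall t, s < t < s + d -> N t.
  case: (pass s (mem_head _ _)) => -[d d0 [dl dr]]; first by exists d.
  have [t [at_ dt ts]] : exists t, [/\ a <= t, s - d < t & t < s].
    exists (Num.max a (s - d / 2)); clear -as_ d0.
    by case: (leP a (s - d / 2)) => ?; split; lra.
  have Nt : N t by apply: dl; rewrite dt ts.
  have Pt : P t by apply: left_of; rewrite at_ ts.
  suff : (P `&` N) t by rewrite PN0.
  by [].
have [a' [sa' a'n a'd]] : exists a', [/\ s < a', a' < n & a' < s + d].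
  exists (Num.min ((s + n) / 2) (s + d / 2)); clear -sn d0.
  by case: (leP ((s + n) / 2) (s + d / 2)) => ?; split; lra.
rewrite if_neg; apply: (IH N P a') => //.
- by rewrite setIC.
- move: sS; rewrite !lt_path_sortedE => /andP[_ ->]; rewrite andbT.
  by apply/allP => t /S_ge_n; exact: lt_le_trans.
- by case: S lastb {IH abPN pass sS S_ge_n} => //= _; exact: lt_le_trans nb.
- move=> t /andP[a't tb] tS; apply/or_comm/abPN.
    by rewrite tb andbT (le_trans (ltW as_))// (le_trans (ltW sa')).
  by rewrite inE negb_or tS andbT gt_eqF// (lt_le_trans sa').
- by move=> u uS; apply/or_comm/pass; rewrite inE uS orbT.
- by apply: right_of; rewrite sa' a'd.
Qed.

End SignChanges.

(** * The two sides of a finite cut *)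

Section Sides.
Variables (R : realType) (G : multigraph).
Implicit Types (X : set (vertex G)) (e : edge G).
Local Notation half := (1 / 2 : R).

Lemma half01 : 0 < half < 1.
Proof. by apply/andP; split; lra. Qed.

Definition midpoint e : realization R G :=
  CWInner e (exist (fun t : R => is_true (0 < t < 1)) half half01).

(** Cut edges are shared at their midpoint; an edge with both end vertices in
    [X] lies entirely on the side of [X]. *)
Definition on_side X e (t : R) : Prop :=
  [\/ X (esrc e) /\ t < half, X (etgt e) /\ half < t | X (esrc e) /\ X (etgt e)].

Definition side X : set (realization R G) :=
  [set p | match p with
           | CWVertex v => X v
           | CWInner e t => on_side X e (val t)
           end].

Lemma open_on_side X e : open [set t | on_side X e t].
Proof.
rewrite /on_side; have [Xs|Xs] := pselect (X (esrc e));
  have [Xt|Xt] := pselect (X (etgt e)).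
- rewrite (_ : [set t | _] = setT); first exact: openT.
  by apply/seteqP; split=> // t _; constructor 3.
- rewrite (_ : [set t | _] = [set t | t < half]); first exact: open_lt.
  by apply/seteqP; split=> t /=; [case=> -[]|move=> th; constructor 1].
- rewrite (_ : [set t | _] = [set t | half < t]); first exact: open_gt.
  by apply/seteqP; split=> t /=; [case=> -[]|move=> th; constructor 2].
- rewrite (_ : [set t | _] = set0); first exact: open0.
  by apply/seteqP; split=> t //=; case=> -[].
Qed.

Lemma open_side X : open (side X).
Proof.
move=> e; apply/open_subspaceP; exists [set t | on_side X e t].
  exact: open_on_side.
have side_cell (t : R) : 0 <= t <= 1 -> on_side X e t <-> side X (cell_map e t).
  move=> /andP[t0 t1]; rewrite /cell_map; case: insubP => [s _ <- //|].
  rewrite /on_side; case: (leP t 0) => t0' /= t01.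
    have -> : t = 0 by lra.
    by split=> [[[]|[]|[]]//|Xs]; [lra|constructor 1; split=> //; lra].
  have -> : t = 1 by lra.
  by split=> [[[]|[]|[]]//|Xs]; [lra|constructor 2; split=> //; lra].
apply/seteqP; split=> t [+ t01]; rewrite /= in_itv in t01 *.
  by move/(side_cell _ t01).
by move/(side_cell _ t01).
Qed.

Lemma side_disjoint X : side X `&` side (~` X) = set0.
Proof.
rewrite -subset0 => -[v [] //|e t []]; rewrite /= /on_side /setC /=.
case=> [] [? ?]; case=> [] [? ?] //; by lra.
Qed.

Lemma side_cover X p :
  side X p \/ side (~` X) p \/ exists2 e, cut X e & p = midpoint e.
Proof.
case: p => [v|e t] /=; first by have [Xv|Xv] := pselect (X v); [left|right; left].
rewrite /on_side /setC /=.
have [Xs|Xs] := pselect (X (esrc e)); have [Xt|Xt] := pselect (X (etgt e)).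
- by left; constructor 3.
- have [th|th|th] := ltgtP (val t) half.
  + by left; constructor 1.
  + by right; left; constructor 2.
  + right; right; exists e; first by exists (esrc e), (etgt e); rewrite /joins eqxx.
    by congr CWInner; apply/val_inj.
- have [th|th|th] := ltgtP (val t) half.
  + by right; left; constructor 1.
  + by left; constructor 2.
  + right; right; exists e.
      by exists (etgt e), (esrc e); rewrite /joins eqxx orbT.
    by congr CWInner; apply/val_inj.
- by right; left; constructor 3.
Qed.

(** An end is on the side of [X] as soon as some compact set confines it there;
    with the compact set left free this is open for any [X]. *)
Definition side_ends X : set (freudenthal (realization R G)) :=
  [set p | match p with
           | FPoint x => side X x
           | FEnd w => exists (K : set (realization R G)) (cK : compact K),
               end_comp w cK `<=` side X
           end].

Lemma open_side_ends X : open (side_ends X).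
Proof.
split; first exact: open_side.
move=> w [K [cK wX]]; exists K, cK => -[x /wX //|w' /= ww'].
by exists K, cK; rewrite ww'.
Qed.

(** Two compact sets confining an end to opposite sides would, by their union,
    confine it to both. *)
Lemma side_ends_disjoint X : side_ends X `&` side_ends (~` X) = set0.
Proof.
rewrite -subset0 => -[x|w] [].
  by move=> Xx Xx'; have : (side X `&` side (~` X)) x by []; rewrite side_disjoint.
move=> [K [cK KX]] [L [cL LX]].
have [x KLx xE] := end_compP w (compactU cK cL).
have wx : end_comp w (compactU cK cL) x.
  by rewrite xE; exact: connected_component_refl.
have : (side X `&` side (~` X)) x.
  split; [apply: KX|apply: LX].
    exact: (end_comp_sub w cK (compactU cK cL) (@subsetUl _ K L)).
  exact: (end_comp_sub w cL (compactU cK cL) (@subsetUr _ K L)).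
by rewrite side_disjoint.
Qed.

(** The midpoints of a finite cut form a compact set, and a connected set
    avoiding them lies on one side. *)
Lemma side_ends_cover X p : finite_set (cut X) ->
  side_ends X p \/ side_ends (~` X) p \/
  exists2 e, cut X e & p = FPoint (midpoint e).
Proof.
move=> fX; case: p => [x|w].
  have [?|[?|[e Xe ->]]] := side_cover X x; [by left|by right; left|].
  by right; right; exists e.
have cK : compact (midpoint @` cut X) by apply/finite_compact/finite_image.
have [x Kx wE] := end_compP w cK.
have sub : end_comp w cK `<=` side X `|` side (~` X).
  rewrite wE => y /connected_component_sub Ky.
  have [?|[?|[e Xe ye]]] := side_cover X y; [by left|by right|].
  by exfalso; apply: Ky; exists e.
have conn : connected (end_comp w cK) by rewrite wE; exact: component_connected.
have [wX|wX] := connected_sub_disjoint_open (@open_side X) (@open_side (~` X))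
  (side_disjoint X) conn sub.
  by left; exists (midpoint @` cut X), cK.
by right; left; exists (midpoint @` cut X), cK.
Qed.

Definition edge_points e (W : set R) : set (freudenthal (realization R G)) :=
  [set p | exists2 s : {t : R | 0 < t < 1}, W (val s) & p = FPoint (CWInner e s)].

Lemma open_edge_points e W : open W -> open (edge_points e W).
Proof.
move=> oW; split; last by move=> w [].
move=> e'; apply/open_subspaceP.
have [<-|ee'] := pselect (e = e'); last first.
  exists set0; first exact: open0.
  rewrite set0I; apply/esym; rewrite -subset0 => t [[s _]].
  by rewrite /cell_map; case: insubP => [u _ _|_] [] // ee; case: ee'.
exists (W `&` [set` `]0, 1[%R]); first by apply: openI => //; exact: itv_open.
apply/seteqP; split=> t [+ t01].
  move=> [Wt]; rewrite /= in_itv /= => tin; split=> //=.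
  rewrite /cell_map; case: insubP => [s _ st|]; last by rewrite tin.
  by exists s => //; rewrite st.
move=> [s Ws]; rewrite /cell_map; case: insubP => // s' s'01 s't [ss'].
split=> //; split; last by rewrite /= in_itv.
by rewrite -s't ss'.
Qed.

(** The value 0 outside open edges is arbitrary. *)
Definition coordinate (p : freudenthal (realization R G)) : R :=
  if p is FPoint (CWInner _ s) then val s else 0.

(** Near [t0] the line stays inside the edge [e], where its coordinate is a
    continuous injective real function, hence strictly monotone: it goes from
    one half of [e] to the other, and these lie on different sides. *)
Lemma passes_midpoint (c : R -> freudenthal (realization R G)) X e t0 :
    continuous c -> injective c -> cut X e -> c t0 = FPoint (midpoint e) ->
  passes (c @^-1` side_ends X) (c @^-1` side_ends (~` X)) t0 \/
  passes (c @^-1` side_ends (~` X)) (c @^-1` side_ends X) t0.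
Proof.
move=> cc inj_c Xe ct0.
have /continuousP cc' := cc.
have op W : open W -> open (c @^-1` edge_points e W).
  by move=> oW; apply: cc'; exact: open_edge_points.
have : nbhs t0 (c @^-1` edge_points e setT).
  apply: open_nbhs_nbhs; split; first exact/op/openT.
  by rewrite /= ct0; eexists.
rewrite -filter_from_ballE => -[d /= d0 dsub].
have in_e t : t0 - d < t < t0 + d -> edge_points e setT (c t).
  by move=> td; apply: dsub; rewrite -ball_normE /= ltr_norml; lra.
pose I := `]t0 - d, t0 + d[%R.
pose tau t := coordinate (c t).
have tau_inj : {in I &, injective tau}.
  move=> t t'; rewrite !in_itv /= => /in_e[s _ cs] /in_e[s' _ cs'].
  rewrite /tau cs cs' /= => /val_inj ss'; apply: inj_c; by rewrite cs cs' ss'.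
have tau_cont : {within [set` I], continuous tau}.
  apply: continuous_in_subspaceT => t /set_mem; rewrite /= in_itv /= => tI.
  have [s _ cs] := in_e _ tI.
  move=> W; rewrite nbhsE => -[V [oV Vt] VW].
  apply: filterS (open_nbhs_nbhs (conj (op _ oV) _)); last first.
    by rewrite /= cs; exists s => //; move: Vt; rewrite /tau cs.
  by move=> u [su Vu cu]; apply: VW; rewrite /tau cu.
have t0I : t0 \in I by rewrite in_itv /=; lra.
have tau0 : tau t0 = half by rewrite /tau ct0.
have side_tau t Y : t0 - d < t < t0 + d -> on_side Y e (tau t) -> side_ends Y (c t).
  by move=> /in_e[s _ cs]; rewrite /tau cs.
have := Xe; rewrite cutE => XY.
have XY' : (X (esrc e) /\ ~ X (etgt e)) \/ (~ X (esrc e) /\ X (etgt e)).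
  move: XY; case: (boolP (esrc e \in X)); case: (boolP (etgt e \in X)) => // Xt Xs _.
    by left; split; [exact: set_mem|move/mem_set; exact/negP].
  by right; split; [move/mem_set; exact/negP|exact: set_mem].
have mono := itv_continuous_inj_mono tau_cont tau_inj.
have lo t : t0 - d < t < t0 -> t \in I by rewrite in_itv /=; lra.
have hi t : t0 < t < t0 + d -> t \in I by rewrite in_itv /=; lra.
have dir : (forall t, t0 - d < t < t0 -> tau t < half) /\
           (forall t, t0 < t < t0 + d -> half < tau t) \/
           (forall t, t0 - d < t < t0 -> half < tau t) /\
           (forall t, t0 < t < t0 + d -> tau t < half).
  rewrite -tau0; case: mono => mono; [left|right];
    split=> t td; apply: mono;
      solve [exact: t0I | exact: lo td | exact: hi td | by case/andP: td].
have ltd t : t0 - d < t < t0 -> t0 - d < t < t0 + d by lra.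
have gtd t : t0 < t < t0 + d -> t0 - d < t < t0 + d by lra.
case: XY' => -[Xs Xt]; case: dir => -[before after]; [left|right|right|left];
  exists d => //; split=> t td; apply: side_tau;
    solve [exact: ltd | exact: gtd
      | by constructor 1; split; [|exact: before || exact: after]
      | by constructor 2; split; [|exact: before || exact: after]].
Qed.
End Sides.

(** * The circle minus a point *)

Section CircleParametrisation.
Variable R : realType.
Implicit Types (t : R) (z : R * R).

Definition stereo_x t := (t ^+ 2 - 1) / (t ^+ 2 + 1).
Definition stereo_y t := 2 * t / (t ^+ 2 + 1).

(** Inverse stereographic projection from [z]: the usual one, from (1, 0),
    followed by the rotation taking (1, 0) to [z]. *)
Definition stereo z t : R * R :=
  (z.1 * stereo_x t - z.2 * stereo_y t, z.2 * stereo_x t + z.1 * stereo_y t).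

Lemma sqrD1_neq0 t : t ^+ 2 + 1 != 0.
Proof. by rewrite gt_eqF// ltr_pwDr// sqr_ge0. Qed.

Lemma stereo_xy t : stereo_x t ^+ 2 + stereo_y t ^+ 2 = 1.
Proof. by rewrite /stereo_x /stereo_y; field; exact: sqrD1_neq0. Qed.

Lemma stereo_circle z t : unit_circle z -> unit_circle (stereo z t).
Proof.
rewrite /unit_circle /= => z1; have := stereo_xy t; nra.
Qed.

Lemma stereo_inj z : unit_circle z -> injective (stereo z).
Proof.
rewrite /unit_circle /= => z1 s t [e1 e2].
have ex : stereo_x s = stereo_x t.
  rewrite -[LHS]mul1r -[RHS]mul1r -z1.
  have -> : (z.1 ^+ 2 + z.2 ^+ 2) * stereo_x s =
    z.1 * (z.1 * stereo_x s - z.2 * stereo_y s) +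
    z.2 * (z.2 * stereo_x s + z.1 * stereo_y s) by ring.
  by rewrite e1 e2; ring.
have ey : stereo_y s = stereo_y t.
  rewrite -[LHS]mul1r -[RHS]mul1r -z1.
  have -> : (z.1 ^+ 2 + z.2 ^+ 2) * stereo_y s =
    z.1 * (z.2 * stereo_x s + z.1 * stereo_y s) -
    z.2 * (z.1 * stereo_x s - z.2 * stereo_y s) by ring.
  by rewrite e1 e2; ring.
(* Stereographic projection recovers the parameter. *)
have inv u : u = stereo_y u / (1 - stereo_x u).
  have -> : 1 - stereo_x u = 2 / (u ^+ 2 + 1).
    by rewrite /stereo_x; field; exact: sqrD1_neq0.
  by rewrite /stereo_y; field; rewrite sqrD1_neq0.
by rewrite [s]inv ex ey -inv.
Qed.

Lemma stereo_surj z z' : unit_circle z -> unit_circle z' -> z' <> z ->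
  exists t, stereo z t = z'.
Proof.
case: z z' => [a b] [a' b']; rewrite /unit_circle /= => ab ab' neq.
(* The coordinates of the second point after rotating [z] back to (1, 0). *)
pose x := a * a' + b * b'; pose y := a * b' - b * a'.
have xy : x ^+ 2 + y ^+ 2 = 1.
  by rewrite -[RHS]mulr1 -{1}ab -ab' /x /y; ring.
have a'E : a' = a * x - b * y by rewrite -[LHS]mul1r -ab /x /y; ring.
have b'E : b' = b * x + a * y by rewrite -[LHS]mul1r -ab /x /y; ring.
have x1 : 1 - x != 0.
  apply/eqP => x1; apply: neq.
  have xe : x = 1 by lra.
  have y0 : y = 0 by move: xy; rewrite xe => xy; nra.
  by rewrite a'E b'E xe y0; congr pair; ring.
exists (y / (1 - x)); rewrite /stereo /= a'E b'E.
have den : (y / (1 - x)) ^+ 2 + 1 = 2 / (1 - x).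
  have -> : (y / (1 - x)) ^+ 2 = y ^+ 2 / (1 - x) ^+ 2 by field.
  have -> : y ^+ 2 = 1 - x ^+ 2 by lra.
  by field.
have -> : stereo_x (y / (1 - x)) = x.
  rewrite /stereo_x; have -> : (y / (1 - x)) ^+ 2 - 1 = 2 * x / (1 - x).
    by rewrite -(addrK 1 ((y / (1 - x)) ^+ 2)) den; field.
  by rewrite den; field.
have -> : stereo_y (y / (1 - x)) = y by rewrite /stereo_y den; field.
by [].
Qed.

Lemma continuous_stereo z : continuous (stereo z).
Proof.
have cx : continuous stereo_x.
  move=> t; apply: cvgM; first by apply: cvgB; [exact: exprn_continuous|exact: cvg_cst].
  apply: cvgV; first exact: sqrD1_neq0.
  by apply: cvgD; [exact: exprn_continuous|exact: cvg_cst].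
have cy : continuous stereo_y.
  move=> t; apply: cvgM; first by apply: cvgM; [exact: cvg_cst|exact: cvg_id].
  apply: cvgV; first exact: sqrD1_neq0.
  by apply: cvgD; [exact: exprn_continuous|exact: cvg_cst].
move=> t; apply: (@cvg_pair _ _ _ _ (nbhs (stereo z t).1) (nbhs (stereo z t).2)).
  by apply: cvgB; (apply: cvgM; [exact: cvg_cst|]); [exact: cx|exact: cy].
by apply: cvgD; (apply: cvgM; [exact: cvg_cst|]); [exact: cx|exact: cy].
Qed.

(** Both ends of the line tend to the centre of projection.  The distance is at
    most 4 / |t| for |t| at least 1. *)
Lemma stereo_near z (W : set (R * R)) : unit_circle z -> nbhs z W ->
  exists M : R, forall t, M <= `|t| -> W (stereo z t).
Proof.
case: z => a b; rewrite /unit_circle /= => ab.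
rewrite -filter_from_ballE => -[e /= e0 eW].
exists (1 + 4 / e) => t Mt; apply: eW.
have e4 : 0 < 4 / e by rewrite divr_gt0.
have t1 : 1 <= `|t| by lra.
have tt : t ^+ 2 = `|t| ^+ 2 by rewrite real_normK ?num_real.
have small : 2 * (1 + `|t|) / (t ^+ 2 + 1) < e.
  rewrite ltr_pdivrMr; last by rewrite ltr_pwDr// sqr_ge0.
  have et : 4 < e * `|t|.
    have -> : 4 = e * (4 / e) by field; rewrite gt_eqF.
    by rewrite ltr_pM2l//; lra.
  by rewrite tt; nra.
have a1 : `|a| <= 1 by rewrite ler_norml; apply/andP; split; nra.
have b1 : `|b| <= 1 by rewrite ler_norml; apply/andP; split; nra.
have d0 : 0 < t ^+ 2 + 1 by rewrite ltr_pwDr// sqr_ge0.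
have xE : stereo_x t - 1 = - (2 / (t ^+ 2 + 1)).
  by rewrite /stereo_x; field; rewrite gt_eqF.
have q0 : 0 <= 2 / (t ^+ 2 + 1) by rewrite divr_ge0// ltW.
have bound p q : `|p| <= 1 -> `|q| <= 1 ->
    `|p * (2 / (t ^+ 2 + 1)) + q * stereo_y t| < e.
  move=> p1 q1; apply: le_lt_trans small; apply: (le_trans (ler_normD _ _)).
  rewrite mulrDr mulr1 mulrDl; apply: lerD.
    by rewrite normrM (ger0_norm q0) ler_piMl.
  rewrite normrM /stereo_y normrM normfV (gtr0_norm d0) normrM.
  rewrite (ger0_norm (ler0n R 2)).
  by rewrite ler_piMl// divr_ge0 ?mulr_ge0// ltW.
split; rewrite -ball_normE /ball_ /=.
  have -> : a - (a * stereo_x t - b * stereo_y t) =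
    a * (2 / (t ^+ 2 + 1)) + b * stereo_y t.
    by rewrite -[2 / _]opprK -xE; ring.
  exact: bound.
have -> : b - (b * stereo_x t + a * stereo_y t) =
    b * (2 / (t ^+ 2 + 1)) + (- a) * stereo_y t.
  by rewrite -[2 / _]opprK -xE; ring.
by apply: bound; rewrite ?normrN.
Qed.

(** A circle with one point [p0] removed is an injective continuous line, both
    ends of which tend to [p0].  This trades the cyclic count of crossings for a
    count along the real line. *)
Lemma punctured_circle_line (T : topologicalType) (C : set T) (p0 : T) :
    is_circle R C -> C p0 ->
  exists c : R -> T, [/\ continuous c, injective c,
    forall p, C p -> p = p0 \/ exists t, c t = p
    & forall U, open U -> U p0 -> exists M : R, forall t, M <= `|t| -> U (c t)].
Proof.
move=> [h [g [<- /subspace_continuousP ch _ gK]]] [z z1 <-].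
exists (h \o stereo z); split.
- move=> t W /= hW.
  have near_t : nbhs t (stereo z @^-1` [set y | unit_circle y -> W (h y)]).
    exact: (@continuous_stereo z t _ (ch _ (stereo_circle t z1) W hW)).
  have : nbhs t ((h \o stereo z) @^-1` W); last by [].
  by apply: filterS near_t => u; apply; exact: stereo_circle.
- move=> s t /(congr1 g) /=; rewrite !gK; try exact: stereo_circle.
  exact: stereo_inj.
- move=> _ [z' z'1 <-]; have [->|zz'] := pselect (z' = z); first by left.
  by right; have [t tz'] := stereo_surj z1 z'1 zz'; exists t; rewrite /= tz'.
- move=> U oU Up0.
  have hU : nbhs z [set y | unit_circle y -> U (h y)].
    by apply: ch => //; exact: open_nbhs_nbhs.
  have [M MU] := stereo_near z1 hU.
  by exists M => t /MU; apply; exact: stereo_circle.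
Qed.
End CircleParametrisation.

(** * Hamiltonian circles meet all finite cuts evenly *)

Lemma midpoint_notin_side (R : realType) (G : multigraph) (X : set (vertex G))
    (e : edge G) : cut X e -> ~ side X (midpoint R e).
Proof.
rewrite cutE => XY; rewrite /side /= /on_side.
case=> -[Xs]; rewrite ?ltxx// => Xt.
by move: XY; rewrite (mem_set Xs) (mem_set Xt).
Qed.

Lemma cut_setC (G : multigraph) (X : set (vertex G)) : cut (~` X) = cut X.
Proof. by apply/seteqP; split=> e; rewrite !cutE !in_setC; do 2!case: (_ \in X). Qed.

(** The set consists of the edges whose midpoint lies on the circle.  The circle
    is cut open at a vertex [v0], so both ends of the resulting line lie on the
    side of [v0] for every finite cut, and the midpoints met are exactly the
    changes of side. *)
Theorem hamiltonian_circle_transversal (R : realType) (G : multigraph)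
    (C : set (freudenthal (realization R G))) : hamiltonian_circle C ->
  exists D : set (edge G), forall X, finite_set (cut X) ->
    ~~ odd #|` fset_set (cut X `&` D)|%fset /\
    (cut X `&` D = set0 -> cut X = set0).
Proof.
move=> [circleC vertexC].
have [[v0 _]|noV] := pselect (exists v : vertex G, True); last first.
  exists set0 => X _; rewrite setI0 fset_set0; split=> // _.
  by rewrite -subset0 => e _; apply: noV; exists (esrc e).
have [c [cc inj_c c_onto c_inf]] := punctured_circle_line circleC (vertexC v0).
exists [set e | exists t, c t = FPoint (midpoint R e)] => X.
(* Both claims are symmetric in [X] and its complement. *)
wlog Xv0 : X / X v0.
  move=> wX; have [|Xv0] := pselect (X v0); first exact: wX.
  by rewrite -cut_setC; apply: wX.
set D := [set e | _] => fX.
pose P := c @^-1` side_ends X; pose N := c @^-1` side_ends (~` X).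
have /continuousP cc' := cc.
have oP : open P by apply: cc'; exact: open_side_ends.
have oN : open N by apply: cc'; exact: open_side_ends.
have PN0 : P `&` N = set0.
  by rewrite /P /N -preimage_setI side_ends_disjoint preimage_set0.
have cover t : P t \/ N t \/
    exists2 e, (cut X `&` D) e & c t = FPoint (midpoint R e).
  have [?|[?|[e Xe te]]] := side_ends_cover (c t) fX; [by left|by right; left|].
  by right; right; exists e => //; split=> //; exists t.
have [M MP] := c_inf _ (@open_side_ends R G X) Xv0.
split.
(* The value 0 for edges off the circle is arbitrary. *)
- pose time e := if pselect (D e) is left De then projT1 (cid De) else 0.
  have timeP e : D e -> c (time e) = FPoint (midpoint R e).
    by move=> De; rewrite /time; case: pselect => // ?; case: cid.
  have fXD : finite_set (cut X `&` D) by apply: sub_finite_set fX => e [].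
  pose ts := sort <=%R [seq time e | e <- fset_set (cut X `&` D)].
  have tsP t : t \in ts -> exists2 e, (cut X `&` D) e & t = time e.
    rewrite mem_sort => /mapP[e]; rewrite in_fset_set// inE => De ->.
    by exists e.
  have pass t : t \in ts -> passes P N t \/ passes N P t.
    by move=> /tsP[e [Xe De] ->]; exact: passes_midpoint cc inj_c Xe (timeP e De).
  have small t : t \in ts -> `|t| < M.
    move=> /tsP[e [Xe De] ->]; rewrite ltNge; apply/negP => /MP.
    by rewrite timeP//=; exact: midpoint_notin_side.
  have uniq_ts : uniq ts.
    rewrite sort_uniq map_inj_in_uniq ?fset_uniq// => e e'.
    rewrite !in_fset_set// !inE => -[_ De] [_ De'] ee'.
    by have := timeP e De; rewrite ee' timeP// => -[].
  pose b := `|M| + 1.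
  have bM : M <= `|b|.
    by rewrite /b; have := ler_norm M; have := ler_norm (`|M| + 1); lra.
  have small_b t : t \in ts -> - b < t < b.
    by move=> /small tM; rewrite -ltr_norml /b; have := ler_norm M; lra.
  have path_ts : path <%R (- b) ts.
    rewrite lt_path_sortedE sort_lt_sorted -(sort_uniq <=%R) uniq_ts andbT.
    by apply/allP => t /small_b/andP[].
  have last_ts : last (- b) ts < b.
    have := mem_last (- b) ts; rewrite inE => /orP[/eqP->|/small_b/andP[]//].
    by rewrite /b; have := normr_ge0 M; lra.
  have Pb : P b by exact: MP.
  have Pb' : P (- b) by apply: MP; rewrite normrN.
  have cover_ts t : - b <= t <= b -> t \notin ts -> P t \/ N t.
    move=> _ tts; have [?|[?|[e eXD te]]] := cover t; [by left|by right|].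
    case/negP: tts; have -> : t = time e.
      by apply: inj_c; rewrite te timeP//; case: eXD.
    by rewrite mem_sort; apply: map_f; rewrite in_fset_set// inE.
  have := sign_changes_parity oP oN PN0 path_ts last_ts cover_ts pass Pb'.
  rewrite size_sort size_map; case: odd => // Nb.
  suff : (P `&` N) b by rewrite PN0.
  by [].
- move=> XD0.
  have cover' t : P t \/ N t.
    by have [?|[?|[e]]] := cover t; [left|right|rewrite XD0].
  have allP t : P t.
    pose a := - (`|M| + `|t|).
    have at_ : a <= t.
      rewrite /a; have := ler_norm (- t); rewrite normrN.
      by have := normr_ge0 M; lra.
    apply: (constant_side oP oN PN0 at_) => //; apply: MP.
    rewrite /a normrN ger0_norm ?addr_ge0//.
    by have := ler_norm M; have := normr_ge0 t; lra.
  have allX v : X v.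
    have [[->//]|[t tv]] := c_onto _ (vertexC v).
    by have := allP t; rewrite /P /= tv.
  by rewrite -subset0 => e [x [y [_ _]]]; apply; exact: allX.
Qed.

(** * Nowhere-zero flows in Z/4 from a Hamiltonian circle *)

Theorem corollary22 (R : realType) (G : multigraph)
  (G_connected : graph_connected G) (G_locally_finite : locally_finite G)
  (G_hamiltonian : exists C : set (freudenthal (realization R G)),
     hamiltonian_circle C) :
  exists f : directed_edge G -> 'Z_4, non_elusive_flow f.
Proof.
have [C /hamiltonian_circle_transversal[D DP]] := G_hamiltonian.
by apply: (@Z4_flow_of_even_transversal G D) => X /DP[].
Qed.
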